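(* Let $n\ge 2$ and let $E,E'$ be strongly independent equations in the unknowns $x_1,\dots,x_n$. Let $m$ be a number such that there exist $m$ common solutions of $E$ and $E'$ of rank $n-1$ which are pairwise linearly nonequivalent. Then (1) $m\le |E|+|E'|$; (2) there exist indices $1\le k<\ell\le n$ such that $m\le 2(|E|_{x_k}+|E|_{x_\ell})$.
   Context: Unknowns $\Xi=\{x_1,\dots,x_n\}$. An equation is a pair $E=(u,v)$ of words over $\Xi$; $|E|=|u|+|v|$ and $|E|_{x}=|u|_x+|v|_x$, where $|w|_x$ counts occurrences of $x$ in $w$. A solution of an equation $(u,v)$ is a monoid morphism $h:\Xi^*\to\{a_1,\dots,a_k\}^*$ with $h(u)=h(v)$. For such $h$ let $\gamma(h)_i=(|h(x_1)|_{a_i},\dots,|h(x_n)|_{a_i})\in\mathbb Q^n$, let $\Gamma_h$ be the $\mathbb Q$-span of $\gamma(h)_1,\dots,\gamma(h)_k$; the rank of $h$ is $\dim\Gamma_h$. Morphisms $h,h'$ are linearly equivalent if $\Gamma_h=\Gamma_{h'}$. Two equations $E,E'$ in $n$ unknowns are strongly independent if the system $\{E,E'\}$ is strongly independent, i.e. $E$ has a solution of rank $n-1$ that is not a solution of $E'$, and $E'$ has a solution of rank $n-1$ that is not a solution of $E$. *)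

(* Defs.v *)
From HB Require Import structures.
From mathcomp Require Import all_boot all_order all_algebra.
Set Implicit Arguments. Unset Strict Implicit. Unset Printing Implicit Defensive.
Import GRing.Theory Num.Theory.

(* Unknowns x_1..x_n are represented by 'I_n (x_{i+1} <-> i). *)
Definition word (n : nat) := seq 'I_n.
Definition equation (n : nat) := (word n * word n)%type.

Definition eq_len n (E : equation n) : nat := size E.1 + size E.2.
Definition eq_occ n (E : equation n) (x : 'I_n) : nat :=
  count_mem x E.1 + count_mem x E.2.

(* A monoid morphism Xi^* -> {a_1..a_k}^*, determined by the images of the
   unknowns; the alphabet size k is part of the data. Letter a_{i+1} <-> i. *)
Record morph (n : nat) := Morph { alph : nat; img : 'I_n -> seq 'I_alph }.

Definition morph_apply n (h : morph n) (w : word n) : seq 'I_(alph h) :=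
  flatten (map (@img n h) w).

Definition is_solution n (h : morph n) (E : equation n) : bool :=
  morph_apply h E.1 == morph_apply h E.2.

Definition gamma n (h : morph n) : 'M[rat]_(alph h, n) :=
  \matrix_(i, j) ((count_mem i (img h j))%:R : rat).

Definition morph_rank n (h : morph n) : nat := \rank (gamma h).

Definition lin_equiv n (h h' : morph n) : bool := (gamma h == gamma h')%MS.

Definition strongly_independent n (E E' : equation n) : Prop :=
  (exists h : morph n, [/\ is_solution h E, morph_rank h = n.-1 & ~~ is_solution h E'])
  /\ (exists h : morph n, [/\ is_solution h E', morph_rank h = n.-1 & ~~ is_solution h E]).

(* Main.v *)
(* For an equation E = (u, v) let Q_(E,x) be the sum of the monomials X^p over the prefixes p
   of u followed by x, minus the same sum for v, where X^p is the commutative image of p.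
   Substitute X_y := t^(L_y), with L_y the length of h(y) for some weighting of the letters.
   A solution h of E satisfies sum_x Q_(E,x) P_(h(x),a) = 0 for all letters a, where P_(w,a) is
   the sum of t^i over the positions i of a in w; for unit weights the converse holds. At t = 1
   the P_(h(x),a) form the matrix gamma(h), so for h of rank n-1 the vectors Q satisfying these
   relations form a line, and every minor
   S = Q_(E,k) Q_(E',l) - Q_(E,l) Q_(E',k) vanishes on the hyperplane Gamma_h of each common
   solution h. Strong independence yields k, l with S <> 0.

   For weights w with w_k, w_l > 0, S is a signed union of N = 2(|E|_k + |E|_l) chains on which
   w strictly increases (fix the factor coming from E and a side of E'). On a hyperplane where
   S vanishes, the minimum of w over the support of S is attained twice, so the minimizers for
   w on the two sides of the hyperplane differ, and minimizers lying in different regions cut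
   out by the hyperplanes belong to different chains. As m hyperplanes meeting the cone cut out
   at least m+1 regions, this bounds the number of hyperplanes other than w_k = 0 and w_l = 0
   by N-1; if one of these two walls also occurs, some chain contains no minimizer, which
   compensates for the walls. This proves (2), and (1) follows by adding (2) to its instance
   with E and E' exchanged, for the same k and l. *)
Require Import Defs.
From mathcomp Require Import all_boot all_order all_algebra.
From mathcomp Require Import ring lra.
Set Implicit Arguments. Unset Strict Implicit. Unset Printing Implicit Defensive.
Import Order.TTheory GRing.Theory Num.Theory.
Local Open Scope ring_scope.

(** * Prefix polynomials of words *)

Fixpoint prefixes_to (T : eqType) (a : T) (w : seq T) : seq (seq T) :=
  if w is x :: w' then nseq (x == a) [::] ++ map (cons x) (prefixes_to a w') else [::].

Definition wlen (T : Type) (c : T -> nat) (w : seq T) : nat := (\sum_(x <- w) c x)%N.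

(** For words over the unknowns this is one side of Q_(E,x); for words over the letters it is
    P_(w,a). *)
Definition qpoly (T : eqType) (c : T -> nat) (a : T) (w : seq T) : {poly rat} :=
  \sum_(p <- prefixes_to a w) 'X^(wlen c p).

Lemma size_prefixes_to (T : eqType) (a : T) w : size (prefixes_to a w) = count_mem a w.
Proof. by elim: w => //= x w IH; rewrite size_cat size_nseq size_map IH. Qed.

(** The longer of two distinct prefixes contains the [a] that follows the shorter one. This is the
    source of the chains. *)
Lemma prefixes_to_comparable (T : eqType) (a : T) w p q :
  p \in prefixes_to a w -> q \in prefixes_to a w ->
  [\/ p = q, exists2 r, a \in r & q = p ++ r | exists2 r, a \in r & p = q ++ r].
Proof.
elim: w p q => //= x w IH p q; rewrite !mem_cat !mem_nseq.
case/orP=> [/andP[xa /eqP->]|/mapP[p' pw ->]];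
  case/orP=> [/andP[xa' /eqP->]|/mapP[q' qw ->]].
- by constructor 1.
- constructor 2; exists (x :: q') => //.
  by move: xa; rewrite lt0b => /eqP->; rewrite mem_head.
- constructor 3; exists (x :: p') => //.
  by move: xa'; rewrite lt0b => /eqP->; rewrite mem_head.
- case: (IH _ _ pw qw) => [->|[r ar ->]|[r ar ->]].
  + by constructor 1.
  + by constructor 2; exists r.
  + by constructor 3; exists r.
Qed.

Section Qpoly.
Variables (T : eqType) (c : T -> nat).

Lemma wlen_cons x w : wlen c (x :: w) = (c x + wlen c w)%N.
Proof. by rewrite /wlen big_cons. Qed.

Lemma wlen_cat w1 w2 : wlen c (w1 ++ w2) = (wlen c w1 + wlen c w2)%N.
Proof. by rewrite /wlen big_cat. Qed.

Lemma qpoly_nil a : qpoly c a [::] = 0.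
Proof. by rewrite /qpoly big_nil. Qed.

Lemma qpoly_cons a x w :
  qpoly c a (x :: w) = (x == a)%:R + 'X^(c x) * qpoly c a w.
Proof.
rewrite /qpoly /= big_cat big_map big_distrr /=; congr (_ + _).
  by case: eqP => _; rewrite /= ?big_nil // big_seq1 /wlen big_nil expr0.
by apply: eq_bigr => p _; rewrite wlen_cons exprD.
Qed.

Lemma qpoly_cat a w1 w2 :
  qpoly c a (w1 ++ w2) = qpoly c a w1 + 'X^(wlen c w1) * qpoly c a w2.
Proof.
elim: w1 => [|x w1 IH] /=.
  by rewrite qpoly_nil add0r /wlen big_nil expr0 mul1r.
by rewrite !qpoly_cons IH wlen_cons mulrDr mulrA -exprD addrA.
Qed.

Lemma horner1_qpoly a w : (qpoly c a w).[1] = (count_mem a w)%:R.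
Proof.
rewrite /qpoly horner_sum (eq_bigr (fun=> 1)) => [|p _]; last first.
  by rewrite hornerXn expr1n.
by rewrite -size_prefixes_to big_const_seq count_predT iter_addr_0.
Qed.

End Qpoly.

(** An occurrence of [a] in the image lies in the image of one occurrence of some [j]; its prefix
    splits into the images of the unknowns before it and a prefix of [h j]. *)
Lemma qpoly_flatten (T : eqType) (J : finType) (c : T -> nat) (h : J -> seq T) a w :
  qpoly c a (flatten (map h w)) =
  \sum_j qpoly (fun j => wlen c (h j)) j w * qpoly c a (h j).
Proof.
elim: w => [|x w IH] /=.
  by rewrite qpoly_nil big1 // => j _; rewrite qpoly_nil mul0r.
rewrite qpoly_cat IH.
under [RHS]eq_bigr do rewrite qpoly_cons mulrDl -mulrA.
rewrite big_split /= -big_distrr /=; congr (_ + _).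
rewrite (bigD1 x) //= eqxx mul1r big1 ?addr0 // => j /negPf.
by rewrite eq_sym => ->; rewrite mul0r.
Qed.

(** With unit weights the constant coefficients reveal the first letter, which then cancels along
    with a factor ['X]. *)
Lemma qpoly_inj (T : eqType) (s1 s2 : seq T) :
  (forall a, qpoly (fun=> 1%N) a s1 = qpoly (fun=> 1%N) a s2) -> s1 = s2.
Proof.
have coef0 (a x : T) s : (qpoly (fun=> 1%N) a (x :: s))`_0 = (x == a)%:R.
  by rewrite qpoly_cons coefD coefXM addr0; case: (x == a); rewrite ?coef1 ?coef0.
elim: s1 s2 => [|x s1 IH] [|y s2] // eqs.
- by have := congr1 (fun p : {poly rat} => p`_0) (eqs y);
     rewrite /= coef0 qpoly_nil coefC eqxx.
- by have := congr1 (fun p : {poly rat} => p`_0) (eqs x);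
     rewrite /= coef0 qpoly_nil coefC eqxx.
have exy : x = y.
  have := congr1 (fun p : {poly rat} => p`_0) (eqs x).
  by rewrite /= !coef0 eqxx; case: eqVneq.
rewrite -exy in eqs *; congr cons; apply: IH => a.
have := eqs a; rewrite !qpoly_cons => /addrI /mulfI; apply.
by rewrite expr1 polyX_eq0.
Qed.

(** * Kernels of matrices of corank at most one *)

Lemma rank_map_eval (F : fieldType) (m n : nat) (a : F) (A : 'M[{poly F}]_(m, n)) :
  (\rank (map_mx (horner_eval a) A) <= \rank (map_mx (@tofrac {poly F}) A))%N.
Proof.
set A1 := map_mx _ A.
(* [B] and [C] compress [A1] to an identity matrix. Lifted to constants, they compress [A] to a
   square matrix whose determinant is 1 at [a], hence nonzero. *)
pose B := map_mx polyC (pinvmx (col_base A1)).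
pose C := map_mx polyC (pinvmx (row_base A1)).
have evC p q (M : 'M[F]_(p, q)) : map_mx (horner_eval a) (map_mx polyC M) = M.
  by apply/matrixP => i j; rewrite !mxE /horner_eval hornerC.
have BAC1 : map_mx (horner_eval a) (B *m A *m C) = 1%:M.
  rewrite !map_mxM !evC -/A1.
  have -> : pinvmx (col_base A1) *m A1 = row_base A1.
    by rewrite -[X in _ *m X = _](mulmx_base A1) mulmxA mulVpmx ?col_base_full ?mul1mx.
  by rewrite mulmxVp ?row_base_free.
have unitBAC : map_mx (@tofrac {poly F}) (B *m A *m C) \in unitmx.
  rewrite unitmxE det_map_mx unitfE tofrac_eq0; apply: contraTneq isT => det0.
  have := congr1 (fun M => \det M) BAC1.
  by rewrite det1 det_map_mx det0 rmorph0 => /eqP; rewrite eq_sym oner_eq0.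
rewrite -(mxrank_unit unitBAC) !map_mxM.
by apply: leq_trans (mxrankM_maxl _ _) (mxrankM_maxr _ _).
Qed.

Lemma minor_kernel_field (F : fieldType) (m n : nat) (A : 'M[F]_(m, n)) (x y : 'cV_n) :
  (n.-1 <= \rank A)%N -> A *m x = 0 -> A *m y = 0 ->
  forall k l, x k 0 * y l 0 = x l 0 * y k 0.
Proof.
move=> rkA Ax Ay k l.
have ker z : A *m z = 0 -> (z^T <= kermx A^T)%MS.
  by move=> Az; apply/sub_kermxP; rewrite -trmx_mul Az trmx0.
case: (eqVneq x 0) => [->|x0]; first by rewrite !mxE !mul0r.
have xr : \rank x^T = 1%N by rewrite rank_rV trmx_eq0 x0.
have kr : (\rank (kermx A^T) <= 1)%N.
  by rewrite mxrank_ker mxrank_tr leq_subLR (leq_trans (leqSpred n)) // -addn1 leq_add2r.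
have : (y^T <= x^T)%MS.
  apply: submx_trans (ker _ _ Ay) _.
  by rewrite -(geq_leqif (mxrank_leqif_sup (ker _ _ Ax))) xr.
case/sub_rVP => a eqy.
have yE i : y i 0 = a * x i 0.
  by have := congr1 (fun M : 'rV_n => M 0 i) eqy; rewrite !mxE.
by rewrite !yE mulrCA [RHS]mulrCA [x k 0 * _]mulrC.
Qed.

(** The rank is required only after evaluation, because at t = 1 the matrix [posmx] becomes
    [gamma h]. *)
Lemma minor_kernel (F : fieldType) (m n : nat) (A : 'M[{poly F}]_(m, n)) a (x y : 'cV_n) :
  (n.-1 <= \rank (map_mx (horner_eval a) A))%N -> A *m x = 0 -> A *m y = 0 ->
  forall k l, x k 0 * y l 0 = x l 0 * y k 0.
Proof.
move=> rkA Ax Ay k l; pose f := @tofrac {poly F}.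
have ker (z : 'cV_n) : A *m z = 0 -> map_mx f A *m map_mx f z = 0.
  by move=> Az; rewrite -map_mxM Az map_mx0.
have := minor_kernel_field (leq_trans rkA (rank_map_eval a A)) (ker _ Ax) (ker _ Ay) k l.
by rewrite !mxE -!tofracM => /eqP; rewrite tofrac_eq => /eqP.
Qed.

(** * Minors of two equations: vanishing at common solutions, and a nonzero one *)

Definition eqpoly n (c : 'I_n -> nat) (E : equation n) (x : 'I_n) : {poly rat} :=
  qpoly c x E.1 - qpoly c x E.2.

Definition eqminor n (c : 'I_n -> nat) (E E' : equation n) (k l : 'I_n) : {poly rat} :=
  eqpoly c E k * eqpoly c E' l - eqpoly c E l * eqpoly c E' k.

Definition lens n (h : morph n) (c : 'I_(alph h) -> nat) (x : 'I_n) : nat :=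
  wlen c (img h x).

Definition posmx n (h : morph n) (c : 'I_(alph h) -> nat) : 'M[{poly rat}]_(alph h, n) :=
  \matrix_(a, x) qpoly c a (img h x).

Lemma eval_posmx n (h : morph n) c : map_mx (horner_eval 1) (posmx (h := h) c) = gamma h.
Proof. by apply/matrixP => a x; rewrite !mxE /horner_eval horner1_qpoly. Qed.

Lemma posmx_eqpoly n (h : morph n) c (E : equation n) a :
  \sum_x eqpoly (lens c) E x * qpoly c a (img h x) =
  qpoly c a (morph_apply h E.1) - qpoly c a (morph_apply h E.2).
Proof.
rewrite /morph_apply !qpoly_flatten -sumrB.
by apply: eq_bigr => x _; rewrite mulrBl.
Qed.

Lemma solution_kernel n (h : morph n) c (E : equation n) :
  is_solution h E -> posmx (h := h) c *m \col_x eqpoly (lens c) E x = 0.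
Proof.
move=> /eqP hE; apply/matrixP => a j; rewrite !mxE.
under eq_bigr do rewrite !mxE mulrC.
by rewrite posmx_eqpoly hE subrr.
Qed.

Lemma common_solution_minor n (h : morph n) c (E E' : equation n) k l :
  is_solution h E -> is_solution h E' -> morph_rank h = n.-1 ->
  eqminor (lens (h := h) c) E E' k l = 0.
Proof.
move=> hE hE' rk; apply/eqP; rewrite subr_eq0.
have rk1 : (n.-1 <= \rank (map_mx (horner_eval 1) (posmx (h := h) c)))%N.
  by rewrite eval_posmx -rk.
have := minor_kernel rk1 (solution_kernel c hE) (solution_kernel c hE') k l.
by rewrite !mxE => ->.
Qed.

Lemma gamma_col0 n (h : morph n) x : img h x = [::] -> gamma h *m delta_mx x (0 : 'I_1) = 0.
Proof.
move=> hx; apply/matrixP => a j; rewrite !mxE big1 // => y _; rewrite !mxE.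
by case: eqVneq => [->|_]; rewrite ?hx ?mul0r // mulr0.
Qed.

(** Each erased unknown puts a unit vector into the kernel of [gamma h], which has dimension at most
    one. *)
Lemma rank_erase_le1 n (h : morph n) x y :
  morph_rank h = n.-1 -> x != y -> img h x = [::] -> img h y <> [::].
Proof.
move=> rk xy hx hy; have rk1 : (n.-1 <= \rank (gamma h))%N by rewrite -rk.
have := minor_kernel_field rk1 (gamma_col0 hx) (gamma_col0 hy) x y.
by rewrite !mxE !eqxx [y == x]eq_sym (negPf xy) mul0r mulr1 => /eqP; rewrite oner_eq0.
Qed.

Lemma qpoly_coef0_ge0 (T : eqType) (c : T -> nat) a w : 0 <= (qpoly c a w)`_0.
Proof.
by rewrite /qpoly coef_sum; apply: sumr_ge0 => p _; rewrite coefXn ler0n.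
Qed.

(** At the first mismatch [x], [y], if [y] has positive weight, the constant coefficient for [x] is
    positive on the side of [x] and 0 on the other. If one word ends first, evaluation at 1
    decides. *)
Lemma qpoly_neq (T : eqType) (c : T -> nat) (u v : seq T) :
  (forall x y, x != y -> (0 < c x)%N || (0 < c y)%N) -> u != v ->
  exists x, qpoly c x u != qpoly c x v.
Proof.
move=> cpos.
have nil_neq y (w : seq T) : qpoly c y (y :: w) != 0.
  apply: contraTneq isT => q0; have := horner1_qpoly c y (y :: w).
  by rewrite q0 horner0 /= eqxx => /eqP; rewrite eq_sym pnatr_eq0.
have cons_neq x y s t : x != y -> (0 < c y)%N -> qpoly c x (x :: s) != qpoly c x (y :: t).
  move=> xy cy; apply: contraTneq isT => /(congr1 (fun p : {poly rat} => p`_0)).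
  rewrite /= !qpoly_cons eqxx eq_sym (negPf xy) !coefD !coefXnM cy coef1 coef0 addr0 /= => q0.
  have : (0 : rat) < 1 + (if (0 < c x)%N then 0 else (qpoly c x s)`_(0 - c x)).
    rewrite ltr_pwDl ?ltr01 //; case: ifP => // _.
    by rewrite sub0n qpoly_coef0_ge0.
  by rewrite q0 ltxx.
elim: u v => [|x u IH] [|y v] //.
- by exists y; rewrite qpoly_nil eq_sym.
- by exists x; rewrite qpoly_nil.
case: (eqVneq x y) => [<-|xy].
  rewrite eqseq_cons eqxx /= => /IH[z uvz]; exists z; rewrite !qpoly_cons.
  have X0 : 'X^(c x) != 0 :> {poly rat} by rewrite expf_neq0 // polyX_eq0.
  by apply: contraNN uvz => /eqP/addrI/(mulfI X0)/eqP.
move=> _; case/orP: (cpos _ _ xy) => ?.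
  by exists y; rewrite eq_sym; apply: cons_neq => //; rewrite eq_sym.
by exists x; apply: cons_neq.
Qed.

(** Fix [k] with Q_(E,k) nonzero. If all minors with this [k] vanished, the vector Q of E' would be
    proportional to that of E, so [h] would solve E' by the converse for unit weights. *)
Lemma exists_eqminor n (h : morph n) (E E' : equation n) :
  is_solution h E -> morph_rank h = n.-1 -> ~~ is_solution h E' -> E.1 != E.2 ->
  exists k l c, eqminor c E E' k l != 0.
Proof.
move=> hE rk hE' nE; pose c := lens (h := h) (fun=> 1%N).
have cpos x y : x != y -> (0 < c x)%N || (0 < c y)%N.
  move=> xy; rewrite /c /lens /wlen !sum1_size !lt0n !size_eq0 -negb_and.
  by apply/negP => /andP[/eqP hx /eqP]; exact: rank_erase_le1 rk xy hx.
have [k] := qpoly_neq cpos nE; rewrite -subr_eq0 => Ek.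
exists k; case: (boolP [exists l, eqminor c E E' k l != 0]) => [/existsP[l ?]|].
  by exists l, c.
rewrite negb_exists => /forallP min0; case/negP: hE'; apply/eqP/qpoly_inj => a.
apply/eqP; rewrite -subr_eq0 -(posmx_eqpoly (fun=> 1%N)) -(mulrI_eq0 _ (mulfI Ek)).
rewrite mulr_sumr; apply/eqP.
transitivity (eqpoly c E' k * \sum_x eqpoly c E x * qpoly (fun=> 1%N) a (img h x)).
  rewrite mulr_sumr; apply: eq_bigr => x _; rewrite !mulrA; congr (_ * _).
  by have := min0 x; rewrite negbK subr_eq0 => /eqP ->; rewrite mulrC.
by rewrite posmx_eqpoly (eqP hE) subrr mulr0.
Qed.

(** * Counting regions by sign vectors *)

Lemma card_cube_edges (I J : finType) (s : J -> {ffun I -> bool}) (p0 : J) :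
  (forall i, exists p q, s p i != s q i /\ forall j, j != i -> s p j = s q j) ->
  (#|I| < #|[set s p | p : J]|)%N.
Proof.
move=> edge; set X := [set _ | _ : J].
pose f (A : {set I}) (a : {ffun I -> bool}) := [ffun j => (j \in A) && a j].
suff: forall k (A : {set I}), #|A| = k -> (k < #|f A @: X|)%N.
  move=> /(_ _ [set: I] erefl); rewrite cardsT => /leq_trans -> //.
  by rewrite leq_imset_card.
elim=> [|k IH] A cA.
  by apply/card_gt0P; exists (f A (s p0)); rewrite imset_f // imset_f.
(* Masking one more coordinate [i] identifies the two ends of the edge in direction [i], so the
   image shrinks. *)
have /card_gt0P[i iA] : (0 < #|A|)%N by rewrite cA.
have cB : #|A :\ i| = k by have := cardsD1 i A; rewrite iA cA add1n => -[].
have fB : f (A :\ i) @: X = f (A :\ i) @: (f A @: X).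
  rewrite -imset_comp; apply: eq_imset => a; apply/ffunP => j; rewrite !ffunE !inE.
  by case: (j == i); case: (j \in A).
apply: leq_ltn_trans (IH _ cB) _; rewrite fB ltn_neqAle leq_imset_card andbT.
apply/negP => /imset_injP inj; have [p [q [pqi pq]]] := edge i.
case/negP: pqi; have : f A (s p) = f A (s q).
  apply: inj; rewrite ?imset_f ?imset_f //.
  apply/ffunP => j; rewrite !ffunE !inE; case: (eqVneq j i) => //= ji.
  by rewrite pq.
by move=> /ffunP/(_ i); rewrite !ffunE iA /= => ->.
Qed.

Lemma card_imset_factor (J A : finType) (C : eqType) (s : J -> A) (x : J -> C) :
  (forall p q, x p = x q -> s p = s q) ->
  (#|[set s p | p : J]| <= size (undup (map x (enum J))))%N.
Proof.
move=> fac; have [p0|J0] := pickP (@predT J); last first.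
  by rewrite (@eq_card0 _ [set s p | p : J]) // => a; apply/imsetP => -[p]; have := J0 p.
pose r a := if [pick p | s p == a] is Some p then p else p0.
have rK a : a \in [set s p | p : J] -> s (r a) = a.
  by case/imsetP=> p _ ->; rewrite /r; case: pickP => [q /eqP|/(_ p)] //; rewrite eqxx.
rewrite cardE -(size_map (x \o r)) => _; apply: uniq_leq_size.
  rewrite map_inj_in_uniq ?enum_uniq // => a b; rewrite !mem_enum => aX bX /fac.
  by rewrite !rK.
by move=> c /mapP[a _ ->]; rewrite mem_undup; apply: map_f; rewrite mem_enum.
Qed.

(** * Minimizers, small perturbations and generic weights *)

Lemma seq_argmin (T : eqType) (f : T -> rat) (D : seq T) :
  D != [::] -> exists2 v, v \in D & forall v', v' \in D -> f v <= f v'.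
Proof.
elim: D => // x D IH _; case: (eqVneq D [::]) => [->|/IH[v vD vmin]].
  by exists x; rewrite ?mem_head // => v'; rewrite inE => /eqP->.
case: (leP (f x) (f v)) => xv.
  exists x; rewrite ?mem_head // => v'; rewrite inE => /orP[/eqP-> //|/vmin].
  exact: le_trans.
exists v; rewrite ?inE ?vD ?orbT // => v'; rewrite inE => /orP[/eqP->|/vmin //].
exact: ltW.
Qed.

(** With [x.1] the value of a linear form at a point and [x.2] its value on a direction, a step of
    size [e] keeps every nonzero sign. *)
Lemma small_scale (s : seq (rat * rat)) :
  exists2 e : rat, 0 < e & forall x, x \in s -> x.1 != 0 -> e * `|x.2| < `|x.1|.
Proof.
elim: s => [|[a b] s [e e0 IH]]; first by exists 1.
have [->|a0] := eqVneq a 0.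
  by exists e => // x; rewrite inE => /orP[/eqP-> /eqP[]//|/IH].
have d0 : 0 < 1 + `|b| by rewrite ltr_pwDl.
have a0' : 0 < `|a| by rewrite normr_gt0.
exists (Num.min e (`|a| / (1 + `|b|))); first by rewrite lt_min e0 divr_gt0.
move=> x; rewrite inE => /orP[/eqP-> _|/IH H /H] /=.
  apply: (@le_lt_trans _ _ (`|a| / (1 + `|b|) * `|b|)).
    by rewrite ler_wpM2r // ge_min lexx orbT.
  by rewrite mulrAC ltr_pdivrMr // ltr_pM2l // ltrDr.
by apply: le_lt_trans; rewrite ler_wpM2r // ge_min lexx.
Qed.

(** The weights are powers of a base [B.+1], so the sum is the value there of the polynomial with
    coefficients [z]; the base avoids the roots of the product of these polynomials. *)
Lemma generic_weight (K : nat) (zs : seq 'cV[rat]_K) :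
  exists2 c : 'I_K -> nat, (forall a, 0 < c a)%N &
    forall z, z \in zs -> z != 0 -> \sum_a (c a)%:R * z a 0 != 0.
Proof.
pose P (z : 'cV[rat]_K) : {poly rat} := \sum_a z a 0 *: 'X^a.
have P_neq0 z : z != 0 -> P z != 0.
  apply: contraNN => /eqP Pz; apply/eqP/matrixP => a j; rewrite ord1 mxE.
  have := congr1 (fun p : {poly rat} => p`_a) Pz; rewrite /= coef0 coef_sum => <-.
  rewrite (bigD1 a) //= coefZ coefXn eqxx mulr1 big1 ?addr0 // => b ba.
  by rewrite coefZ coefXn eq_sym -val_eqE in ba *; rewrite (negPf ba) mulr0.
pose Q := \prod_(z <- zs | z != 0) P z.
have Q0 : Q != 0 by rewrite prodf_seq_neq0; apply/allP => z _; apply/implyP/P_neq0.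
have [B nrB] : exists B, ~~ root Q (B.+1)%:R.
  pose rs : seq rat := [seq (B.+1)%:R | B <- iota 0 (size Q)].
  have : ~~ all (root Q) rs.
    apply/negP => /(max_poly_roots Q0); rewrite size_map size_iota ltnn => H.
    suff: false by []. apply: H; rewrite map_inj_uniq ?iota_uniq // => x y /eqP.
    by rewrite eqr_nat eqSS => /eqP.
  by case/allPn=> _ /mapP[B _ ->]; exists B.
exists (fun a : 'I_K => (B.+1 ^ a)%N) => [a|z zzs z0]; first by rewrite expn_gt0.
apply: contraNneq nrB => sum0; rewrite /root /Q horner_prod prodf_seq_eq0.
apply/hasP; exists z => //; rewrite z0 /= /P horner_sum.
by apply/eqP; rewrite -[RHS]sum0; apply: eq_bigr => a _; rewrite hornerZ hornerXn natrX mulrC.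
Qed.

(** * Distinct minimizers in distinct regions *)

Definition dot n (w : 'rV[rat]_n) (v : 'cV[rat]_n) : rat := (w *m v) 0 0.

Section Dot.
Variable n : nat.
Implicit Types (w : 'rV[rat]_n) (v : 'cV[rat]_n).

Lemma dotDl w w' v : dot (w + w') v = dot w v + dot w' v.
Proof. by rewrite /dot mulmxDl mxE. Qed.

Lemma dotZl a w v : dot (a *: w) v = a * dot w v.
Proof. by rewrite /dot -scalemxAl mxE. Qed.

Lemma dotBr w v v' : dot w (v - v') = dot w v - dot w v'.
Proof. by rewrite /dot mulmxBr !mxE. Qed.

Lemma dotE w v : dot w v = \sum_i w 0 i * v i 0.
Proof. by rewrite /dot mxE. Qed.

End Dot.

(** If a linear form takes the values [a] and [b] at two points, it vanishes at the combination with
    these positive coefficients. *)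
Lemma opposite_signs (a b : rat) :
  a != 0 -> b != 0 -> (0 < a) != (0 < b) -> `|b| * a + `|a| * b = 0.
Proof. by case: (ltrgt0P a) => // _; case: (ltrgt0P b) => // _ _ _ _; ring. Qed.

Lemma add_small_sign (a b : rat) : `|b| < `|a| -> a + b != 0 /\ (0 < a + b) = (0 < a).
Proof.
rewrite ltr_norml; case: (ltrgt0P a) => a0 /andP[h1 h2].
- have ab : 0 < a + b by lra.
  by rewrite ab gt_eqF.
- have ab : a + b < 0 by lra.
  by rewrite lt_eqF // ltNge ltW.
- by move: (lt_trans h1 h2); rewrite oppr0 ltxx.
Qed.

(* Each [pt i] is moved off its hyperplane to both sides in a generic direction. A minimizer
   shared by points on opposite sides of hyperplane [i] also minimizes at the crossing point,
   where [tie] gives a second minimizer; both then tie at the two generic points. *)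
Lemma distinct_minimizers n (D G : seq 'cV[rat]_n) (I : finType)
    (nu : I -> 'cV[rat]_n) (pt : I -> 'rV[rat]_n) (base : 'rV[rat]_n)
    (C : eqType) (chi : 'cV[rat]_n -> C) :
  D != [::] ->
  (forall g, g \in G -> 0 < dot base g) ->
  (forall i g, g \in G -> 0 < dot (pt i) g) ->
  (forall i, nu i != 0) ->
  (forall i, dot (pt i) (nu i) = 0) ->
  (forall i j, j != i -> dot (pt i) (nu j) != 0) ->
  (forall i w v, dot w (nu i) = 0 -> v \in D ->
     exists v', [/\ v' \in D, v' != v & dot w v' = dot w v]) ->
  (forall v v', v \in D -> v' \in D -> chi v = chi v' ->
     [\/ v = v', v' - v \in G | v - v' \in G]) ->
  exists2 vs : seq 'cV[rat]_n, (#|I| < size (undup (map chi vs)))%N &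
    forall v, v \in vs -> v \in D /\
      exists2 w, (forall g, g \in G -> 0 < dot w g)
               & forall v', v' \in D -> dot w v <= dot w v'.
Proof.
move=> D0 baseG ptG nu0 ptnu ptnu' tie chain.
pose L := [seq nu i | i : I] ++ [seq v - v' | v <- D, v' <- D].
have nuL i : nu i \in L by rewrite mem_cat; apply/orP; left; apply: map_f; rewrite mem_enum.
have diffL v v' : v \in D -> v' \in D -> v - v' \in L.
  by move=> vD vD'; rewrite mem_cat; apply/orP; right; apply/allpairsP; exists (v, v').
have [c _ gen] := generic_weight L.
pose d : 'rV[rat]_n := \row_a (c a)%:R.
have dL g : g \in L -> g != 0 -> dot d g != 0.
  move=> gL g0; rewrite dotE; have := gen g gL g0.
  apply: contraNN => /eqP eq0; apply/eqP; rewrite -[RHS]eq0.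
  by apply: eq_bigr => a _; rewrite mxE.
(* [Some (i, b)] is a perturbation of [pt i] to one side; [None] provides a point even if [I] is
   empty. *)
pose J : finType := option (I * bool).
pose bs (p : J) := if p is Some (i, _) then pt i else base.
have [e e0 small] := small_scale [seq (dot (bs p) g, dot d g) | p <- enum J, g <- G ++ L].
have {}small p g : g \in G ++ L -> dot (bs p) g != 0 -> e * `|dot d g| < `|dot (bs p) g|.
  move=> gGL; apply: (small (_, _)); apply/allpairsP; exists (p, g); split=> //.
  by rewrite mem_enum.
pose sg (p : J) : rat := if p is Some (_, false) then - e else e.
have sg0 p : `|sg p| = e by case: p => [[i []]|]; rewrite /sg ?normrN gtr0_norm.
pose w p := bs p + sg p *: d.
have wE p g : dot (w p) g = dot (bs p) g + sg p * dot d g by rewrite dotDl dotZl.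
have bsG p g : g \in G -> 0 < dot (bs p) g by case: p => [[i b]|]; [apply: ptG|apply: baseG].
have wsign p g : g \in G ++ L -> dot (bs p) g != 0 ->
    dot (w p) g != 0 /\ (0 < dot (w p) g) = (0 < dot (bs p) g).
  by move=> gGL b0; have := small p g gGL b0; rewrite wE -(sg0 p) -normrM => /add_small_sign.
have wG p g : g \in G -> 0 < dot (w p) g.
  move=> gG; have b0 : dot (bs p) g != 0 by rewrite gt_eqF // bsG.
  by have [|_ ->] := wsign p g _ b0; rewrite ?mem_cat ?gG // bsG.
have wL p g : g \in L -> g != 0 -> dot (w p) g != 0.
  move=> gL g0; have [b0|b0] := eqVneq (dot (bs p) g) 0.
    by rewrite wE b0 add0r mulf_neq0 ?dL // -normr_gt0 sg0.
  by have [] := wsign p g _ b0; rewrite // mem_cat gL orbT.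
have argmin p : exists v, (v \in D) && all (fun v' => dot (w p) v <= dot (w p) v') D.
  by have [v vD /allP vmin] := seq_argmin (dot (w p)) D0; exists v; rewrite vD.
pose vx p := xchoose (argmin p).
have vxD p : vx p \in D by have /andP[] := xchooseP (argmin p).
have vxmin p v : v \in D -> dot (w p) (vx p) <= dot (w p) v.
  by have /andP[_ /allP] := xchooseP (argmin p); apply.
exists [seq vx p | p <- enum J]; last first.
  by move=> v /mapP[p _ ->]; split=> //; exists (w p); [exact: wG|exact: vxmin].
rewrite -map_comp; pose s p := [ffun i => 0 < dot (w p) (nu i)].
apply: leq_trans (card_imset_factor (s := s) _).
  apply: (card_cube_edges None) => i.
  exists (Some (i, true)), (Some (i, false)); split.
    rewrite !ffunE !wE /= ptnu !add0r mulNr oppr_gt0 pmulr_rgt0 // pmulr_rlt0 //.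
    by have := dL _ (nuL i) (nu0 i); case: ltrgt0P.
  move=> j ji; rewrite !ffunE.
  have nuGL : nu j \in G ++ L by rewrite mem_cat nuL orbT.
  by rewrite (wsign (Some (i, true)) _ nuGL _).2 ?(wsign (Some (i, false)) _ nuGL _).2 //;
     apply: ptnu'.
move=> p q /= chipq.
(* Every [w p] strictly increases along a chain, so minimizers in one chain coincide. *)
have vpq : vx p = vx q.
  case: (chain _ _ (vxD p) (vxD q) chipq) => // /wG gt0.
    by have := gt0 q; rewrite dotBr subr_gt0 ltNge vxmin.
  by have := gt0 p; rewrite dotBr subr_gt0 ltNge vxmin.
apply/ffunP => i; rewrite !ffunE; apply/eqP/negPn/negP => opp.
have a0 := wL p _ (nuL i) (nu0 i); have b0 := wL q _ (nuL i) (nu0 i).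
set a := dot (w p) (nu i) in opp a0; set b := dot (w q) (nu i) in opp b0.
have := opposite_signs a0 b0 opp; rewrite -!dotZl -dotDl => /tie/(_ (vxD p)).
case=> v [vD vvx]; rewrite !dotDl !dotZl => eqv.
have := vxmin p v vD; have := vxmin q v vD; rewrite -vpq => hq hp.
have : dot (w p) (v - vx p) != 0 by rewrite wL ?diffL // subr_eq0.
rewrite dotBr subr_eq0; case/negP; apply/eqP.
have : `|b| * (dot (w p) v - dot (w p) (vx p)) + `|a| * (dot (w q) v - dot (w q) (vx p)) = 0.
  by rewrite !mulrBr; lra.
move/eqP; rewrite paddr_eq0 ?mulr_ge0 ?subr_ge0 // => /andP[].
by rewrite mulf_eq0 normr_eq0 (negPf b0) subr_eq0 => /eqP.
Qed.

(** * Auxiliary facts on multisets and hyperplanes *)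

Lemma count_excess (T : eqType) (A : pred T) (s1 s2 : seq T) v0 :
  count A s1 = count A s2 -> A v0 -> (count_mem v0 s2 < count_mem v0 s1)%N ->
  exists2 v, A v & (count_mem v s1 < count_mem v s2)%N.
Proof.
move=> cA Av0 lt0.
have cfil s v : A v -> count_mem v (filter A s) = count_mem v s.
  move=> Av; rewrite count_filter; apply: eq_count => x /=.
  by case: eqP => // ->; rewrite Av.
pose f1 := filter A s1; pose f2 := filter A s2.
(* Without an excess in [s2], [f2] would be a submultiset of [f1] of the same size, hence equal to
   it. *)
case: (boolP (all (fun v => (count_mem v f2 <= count_mem v f1)%N) f2)) => [/allP le21|].
  have /count_subseqP[s sub21 peq] : forall v, (count_mem v f2 <= count_mem v f1)%N.
    by move=> v; have [/le21//|/count_memPn->] := boolP (v \in f2).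
  have : s = f1.
    apply/eqP; rewrite -(size_subseq_leqif sub21) -(perm_size peq) !size_filter.
    by rewrite cA.
  move=> e1; move: lt0; rewrite -(cfil s1) // -(cfil s2) // -/f1 -/f2 -e1.
  by move/permP: peq => ->; rewrite ltnn.
case/allPn=> v; rewrite mem_filter => /andP[Av _]; rewrite -ltnNge !cfil // => lt.
by exists v.
Qed.

Lemma sub_hyperplane (m n : nat) (A : 'M[rat]_(m, n)) (nu : 'cV_n) q (B : 'M_(q, n)) :
  \rank A = n.-1 -> nu != 0 -> A *m nu = 0 -> (B <= A)%MS = (B *m nu == 0).
Proof.
move=> rkA nu0 Anu; have AK : (A <= kermx nu)%MS by apply/sub_kermxP.
have rkK : \rank (kermx nu) = n.-1.
  by rewrite mxrank_ker -mxrank_tr rank_rV trmx_eq0 nu0 subn1.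
have KA : (kermx nu <= A)%MS by rewrite -(geq_leqif (mxrank_leqif_sup AK)) rkA rkK.
apply/idP/eqP => [BA|/sub_kermxP BK]; last exact: submx_trans BK KA.
by apply/sub_kermxP; exact: submx_trans BA AK.
Qed.

Lemma hyperplane_normal (m n : nat) (A : 'M[rat]_(m, n)) :
  (0 < n)%N -> \rank A = n.-1 -> exists2 nu : 'cV[rat]_n, nu != 0 & A *m nu = 0.
Proof.
move=> n0 rkA; exists (nz_row (kermx A^T))^T.
  rewrite trmx_eq0 nz_row_eq0 -mxrank_eq0 mxrank_ker mxrank_tr rkA.
  by case: n n0 {A rkA} => // n _; rewrite subSnn.
apply: trmx_inj; rewrite trmx_mul trmxK trmx0.
by apply/sub_kermxP; exact: nz_row_sub.
Qed.

(** * Bounding the hyperplanes on which a signed union of chains vanishes *)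

Definition pos_at n (k l : 'I_n) (g : 'cV[rat]_n) : bool :=
  [forall j, 0 <= g j 0] && ((0 < g k 0) || (0 < g l 0)).

Section ChainBound.
Variables (n : nat) (k l : 'I_n) (P M : seq (seq 'cV[rat]_n)).

Let excess v := (count_mem v (flatten P) < count_mem v (flatten M))%N.
Let supp := [seq v <- undup (flatten P ++ flatten M) |
  count_mem v (flatten P) != count_mem v (flatten M)].
(* The index of a chain of [P ++ M] containing [v] with the sign of its coefficient. *)
Let chain_of (v : 'cV[rat]_n) : nat :=
  if excess v then (size P + find (fun s => v \in s) M)%N else find (fun s => v \in s) P.
(** Finitely many constraints define the open cone: the unit vectors force w_k, w_l > 0, and the
    differences make weights increase along chains. *)
Let cone := filter (pos_at k l)
  (delta_mx k 0 :: delta_mx l 0 :: [seq v - v' | v <- supp, v' <- supp]).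

Hypothesis chains : forall s, s \in P ++ M -> forall v v', v \in s -> v' \in s ->
  [\/ v = v', pos_at k l (v' - v) | pos_at k l (v - v')].

Let mem_supp v :
  (v \in supp) = (count_mem v (flatten P) != count_mem v (flatten M)).
Proof.
rewrite mem_filter mem_undup mem_cat; case: eqP => //= neq.
apply/negPn/negP; rewrite negb_or => /andP[/count_memPn cP /count_memPn cM].
by case: neq; rewrite cP cM.
Qed.

Let chain_ofP v : v \in supp -> (chain_of v < size P + size M)%N /\
  v \in nth [::] (P ++ M) (chain_of v).
Proof.
rewrite mem_supp /chain_of /excess neq_ltn nth_cat.
have findP S : (0 < count_mem v (flatten S))%N ->
    (find (fun s => v \in s) S < size S)%N /\ v \in nth [::] S (find (fun s => v \in s) S).
  rewrite -has_count has_pred1 => /flattenP[s sS vs].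
  have hS : has (fun s => v \in s) S by apply/hasP; exists s.
  by rewrite -has_find hS; split=> //; exact: (nth_find [::] hS).
case: ltnP => [lt _|ge /= lt].
  have [] := findP M (leq_ltn_trans (leq0n _) lt).
  by rewrite ltn_add2l [(_ + _ < size P)%N]ltnNge leq_addr /= addKn.
have [lt1 ?] := findP P (leq_ltn_trans (leq0n _) lt).
by rewrite lt1 ltn_addr.
Qed.

(** Chains of [P] have the smaller indices and are assigned only to exponents with positive
    coefficient. *)
Let chain_of_excess v v' : v \in supp -> v' \in supp ->
  chain_of v = chain_of v' -> excess v = excess v'.
Proof.
move=> vS vS'; have lt u : u \in supp -> ~~ excess u -> (chain_of u < size P)%N.
  move=> uS nu; have [_] := chain_ofP uS; rewrite /chain_of (negPf nu) nth_cat.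
  case: ifP => // /negP nlt _; case: nlt; rewrite -has_find.
  move: uS nu; rewrite mem_supp /excess neq_ltn => /orP[->//|lt _].
  have : u \in flatten P by rewrite -has_pred1 has_count (leq_ltn_trans _ lt).
  by case/flattenP=> s sP us; apply/hasP; exists s.
have ge u : excess u -> (size P <= chain_of u)%N.
  by rewrite /chain_of => ->; rewrite leq_addr.
move=> eqc; apply/idP/idP => h; apply/negPn/negP => nh.
  by have := ge _ h; rewrite eqc leqNgt lt.
by have := ge _ h; rewrite -eqc leqNgt lt.
Qed.

Let cone_diff v v' : v \in supp -> v' \in supp -> pos_at k l (v' - v) -> v' - v \in cone.
Proof.
move=> vS vS' pos; rewrite mem_filter pos !inE; apply/orP; right; apply/orP; right.
by apply/allpairsP; exists (v', v).
Qed.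

Let same_chain v v' : v \in supp -> v' \in supp -> chain_of v = chain_of v' ->
  [\/ v = v', pos_at k l (v' - v) | pos_at k l (v - v')].
Proof.
move=> vS vS' eqc; have [lt vn] := chain_ofP vS; have [_ vn'] := chain_ofP vS'.
by apply: chains vn _; rewrite ?eqc // mem_nth // -eqc size_cat.
Qed.

Let cone_pos w k0 : k0 \in [:: k; l] ->
  (forall g, g \in cone -> 0 < dot w g) -> 0 < w 0 k0.
Proof.
move=> k0kl wpos; have dE : dot w (delta_mx k0 0) = w 0 k0.
  rewrite dotE (bigD1 k0) //= !mxE !eqxx mulr1 big1 ?addr0 // => j /negPf jk.
  by rewrite !mxE jk mulr0.
rewrite -dE; apply: wpos; rewrite mem_filter.
have -> : pos_at k l (delta_mx k0 0).
  apply/andP; split; first by apply/forallP => j; rewrite mxE ler0n.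
  by move: k0kl; rewrite !inE !mxE => /orP[]/eqP->; rewrite !eqxx ?ltr01 ?orbT.
by move: k0kl; rewrite !inE => /orP[]/eqP->; rewrite eqxx ?orbT.
Qed.

Let pos_cone (w : 'rV[rat]_n) : (forall j, 0 <= w 0 j) -> 0 < w 0 k -> 0 < w 0 l ->
  forall g, g \in cone -> 0 < dot w g.
Proof.
move=> w0 wk wl g; rewrite mem_filter => /andP[/andP[/forallP g0 gkl] _].
have wg j : 0 <= w 0 j * g j 0 by rewrite mulr_ge0.
case/orP: gkl => gp; rewrite dotE.
  by rewrite (bigD1 k) //= ltr_pwDl ?mulr_gt0 // sumr_ge0.
by rewrite (bigD1 l) //= ltr_pwDl ?mulr_gt0 // sumr_ge0.
Qed.

(** The signed sum of monomials vanishes once exponents are identified modulo the kernel of [A]. *)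
Definition balanced m (A : 'M[rat]_(m, n)) := forall v0 : 'cV[rat]_n,
  count (fun v => A *m v == A *m v0) (flatten P) =
  count (fun v => A *m v == A *m v0) (flatten M).

Let balanced_opposite m (A : 'M[rat]_(m, n)) v0 : balanced A -> v0 \in supp ->
  exists v, [/\ v \in supp, A *m v = A *m v0 & excess v = ~~ excess v0].
Proof.
move=> bal; rewrite mem_supp neq_ltn => /orP[]lt.
  have [v /eqP eqA lt'] := count_excess (esym (bal v0)) (eqxx _) lt.
  exists v; rewrite mem_supp eqA /excess lt; split=> //; first by rewrite neq_ltn lt' orbT.
  by rewrite ltnNge ltnW.
have [v /eqP eqA lt'] := count_excess (bal v0) (eqxx _) lt.
exists v; rewrite mem_supp eqA /excess lt'; split=> //; first by rewrite neq_ltn lt'.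
by rewrite ltnNge (ltnW lt).
Qed.

(* The first minimizers on a wall of the cone form a string in direction [k0] containing
   both signs; the chain of an element of the sign opposite to that of its endpoint
   has no minimizer over the open cone. *)
Let wall_chain k0 m (A : 'M[rat]_(m, n)) :
  k0 \in [:: k; l] -> supp != [::] -> balanced A ->
  \rank A = n.-1 -> A *m delta_mx k0 (0 : 'I_1) = 0 ->
  exists2 c0, (c0 < size P + size M)%N &
    forall v w, v \in supp -> (forall g, g \in cone -> 0 < dot w g) ->
      (forall v', v' \in supp -> dot w v <= dot w v') -> chain_of v != c0.
Proof.
move=> k0kl S0 bal rkA Ak0.
have ek0 : delta_mx k0 0 != 0 :> 'cV[rat]_n.
  by apply/eqP => /matrixP/(_ k0 0)/eqP; rewrite !mxE !eqxx oner_eq0.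
have wallA q (B : 'M_(q, n)) := sub_hyperplane B rkA ek0 Ak0.
(* The row space of [A] contains every unit row other than that of [k0]. *)
have wall_eq (v v' : 'cV[rat]_n) :
    A *m v = A *m v' -> forall j, j != k0 -> v j 0 = v' j 0.
  move=> eqA j jk.
  have /submxP[D dj] : ((delta_mx 0 j : 'rV_n) <= A)%MS.
    rewrite wallA; apply/eqP/matrixP => a b; rewrite !mxE big1 // => i _.
    by rewrite !mxE; case: (eqVneq i j) => [->|_]; rewrite ?(negPf jk) ?andbF ?mul0r ?mulr0.
  have := congr1 (fun B => (D *m B) 0 0) eqA; rewrite !mulmxA -dj.
  by rewrite -!rowE !mxE.
(* A weight on the wall. Among its minimizers [v2] is lowest in direction [k0], and [v3] has the
   opposite sign on the same line. *)
pose w0 : 'rV[rat]_n := \row_j (j != k0)%:R.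
have w0E v : dot w0 v = \sum_(j | j != k0) v j 0.
  rewrite dotE [RHS]big_mkcond /=; apply: eq_bigr => j _; rewrite mxE.
  by case: (j == k0); rewrite ?mul1r ?mul0r.
have [v1 v1S v1min] := seq_argmin (dot w0) S0.
pose S1 := [seq v <- supp | dot w0 v == dot w0 v1].
have S10 : S1 != [::].
  by apply: contraTneq v1S => S1e; have := mem_filter (fun v => dot w0 v == dot w0 v1) v1 supp;
     rewrite -/S1 S1e eqxx /= => <-.
have [v2 v2S1 v2min] := seq_argmin (fun v : 'cV[rat]_n => v k0 0) S10.
move: (v2S1); rewrite mem_filter => /andP[/eqP w0v2 v2S].
have [v3 [v3S eqA ex3]] := balanced_opposite bal v2S.
have v3j := wall_eq _ _ eqA.
have w0v3 : dot w0 v3 = dot w0 v1.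
  by rewrite -w0v2 !w0E; apply: eq_bigr => j /v3j.
exists (chain_of v3) => [|v w vS wpos vmin]; first by have [] := chain_ofP v3S.
apply/eqP => eqc; have exv := chain_of_excess vS v3S eqc.
(* As [v] is minimal for [w], [v3] cannot precede it in their chain. *)
have ge0 : forall j, 0 <= (v3 - v) j 0.
  case: (same_chain vS v3S eqc) => [->|/andP[/forallP]//|pos] j.
    by rewrite subrr mxE.
  by have := wpos _ (cone_diff v3S vS pos); rewrite dotBr subr_gt0 ltNge vmin.
have vj j : j != k0 -> v j 0 = v2 j 0.
  move=> jk; rewrite -v3j //; apply/esym/eqP; rewrite -subr_eq0.
  have : dot w0 (v3 - v) == 0.
    rewrite eq_le; apply/andP; split; first by rewrite dotBr subr_le0 w0v3 v1min.
    by rewrite w0E sumr_ge0.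
  rewrite w0E psumr_eq0 // => /allP/(_ j); rewrite mem_index_enum jk !mxE => /(_ isT).
  by [].
have vv2 : v != v2.
  by apply/eqP => vv2; move: exv; rewrite vv2 ex3; case: (excess v2).
have vS1 : v \in S1.
  rewrite mem_filter vS andbT -w0v2 !w0E; apply/eqP/eq_bigr => j; exact: vj.
(* [v] is on the line of [v2] but has the opposite sign, so it lies strictly above [v2] and is
   heavier for [w]. *)
have lt : v2 k0 0 < v k0 0.
  rewrite lt_neqAle v2min // andbT; apply: contraNneq vv2 => eqk.
  apply/eqP/matrixP => j a; rewrite ord1; case: (eqVneq j k0) => [->//|]; exact: vj.
have := vmin _ v2S; rewrite leNgt => /negP; apply.
rewrite -subr_gt0 -dotBr dotE (bigD1 k0) //= big1 ?addr0 => [|j jk].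
  by rewrite mulr_gt0 ?(cone_pos k0kl wpos) // !mxE subr_gt0.
by rewrite !mxE vj // subrr mulr0.
Qed.

Lemma chain_bound m (K : 'I_m -> nat) (A : forall i, 'M[rat]_(K i, n)) :
  (exists v, count_mem v (flatten P) != count_mem v (flatten M)) ->
  (forall i a j, 0 <= A i a j) -> (forall i, \rank (A i) = n.-1) ->
  (forall i j, i != j -> ~~ (A i == A j)%MS) -> (forall i, balanced (A i)) ->
  (m <= size P + size M)%N.
Proof.
case=> v0; rewrite -mem_supp => v0S A0 rkA neqA bal.
have S0 : supp != [::] by apply: contraTneq v0S => ->.
have n0 : (0 < n)%N by exact: leq_ltn_trans (ltn_ord k).
have [nu nu0 Anu] := fin_all_exists2 (fun i => hyperplane_normal n0 (rkA i)).
have subA i q (B : 'M_(q, n)) := sub_hyperplane B (rkA i) (nu0 i) (Anu i).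
have Anu' i j : j != i -> A i *m nu j != 0.
  move=> ji; apply/negP; rewrite -subA => Aij; have /negP := neqA _ _ ji; apply.
  by rewrite Aij andbT -(geq_leqif (mxrank_leqif_sup Aij)) !rkA.
(* [wall k0 i] says that the row space of [A i] is the hyperplane w_k0 = 0. *)
pose wall k0 := [pred i | A i *m delta_mx k0 (0 : 'I_1) == 0].
have wall_le1 k0 : (#|wall k0| <= 1)%N.
  apply/card_le1_eqP => i j; rewrite !inE => /eqP wi /eqP wj.
  apply/eqP/negPn/negP => ij; case/negP: (neqA _ _ ij).
  have e0 : delta_mx k0 0 != 0 :> 'cV[rat]_n.
    by apply/eqP => /matrixP/(_ k0 0)/eqP; rewrite !mxE !eqxx oner_eq0.
  by rewrite (sub_hyperplane _ (rkA i) e0 wi) (sub_hyperplane _ (rkA j) e0 wj) wi wj !eqxx.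
pose good := [pred i | ~~ wall k i && ~~ wall l i].
have m_le : (m <= #|good| + (#|wall k| + #|wall l|))%N.
  rewrite -{1}(card_ord m) -(cardID good) leq_add //.
  rewrite -cardUI (leq_trans _ (leq_addr _ _)) //.
  by apply: subset_leq_card; apply/subsetP => i; rewrite !inE andbT negb_and !negbK.
have [c c0 gen] := fin_all_exists2 (fun i =>
  generic_weight [seq A i *m nu j | j <- enum 'I_m]).
(* A generic positive combination of the rows of [A i]: it avoids the other hyperplanes, and its
   entries at [k] and [l] are positive when [i] is good. *)
pose pt i : 'rV[rat]_n := (\row_a (c i a)%:R) *m A i.
have dot_pt i v : dot (pt i) v = \sum_a (c i a)%:R * (A i *m v) a 0.
  by rewrite /dot -mulmxA mxE; apply: eq_bigr => a _; rewrite mxE.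
have ptE i j : pt i 0 j = \sum_a (c i a)%:R * A i a j.
  by rewrite mxE; apply: eq_bigr => a _; rewrite mxE.
have pt0 i j : 0 <= pt i 0 j.
  by rewrite ptE sumr_ge0 // => a _; rewrite mulr_ge0.
have ptk i k0 : ~~ wall k0 i -> 0 < pt i 0 k0.
  move=> nw; rewrite lt_neqAle pt0 andbT eq_sym; apply: contraNneq nw.
  rewrite ptE => /eqP; rewrite psumr_eq0 => [/allP z|a _]; last by rewrite mulr_ge0.
  apply/eqP/matrixP => a b; rewrite !mxE big1 // => j _; rewrite !mxE.
  case: eqVneq => [->|_]; last by rewrite mulr0.
  have := z a (mem_index_enum _); rewrite /= mulf_eq0 pnatr_eq0 -leqn0 leqNgt c0 /=.
  by move=> /eqP->; rewrite mul0r.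
have [|||||||| vs vs_gt vsP] := @distinct_minimizers n supp cone {i | good i}
    (fun i => nu (val i)) (fun i => pt (val i)) (const_mx 1) _ chain_of => //.
- by apply: pos_cone => [j||]; rewrite mxE.
- move=> i g; have /andP[gk gl] := valP i.
  by apply: pos_cone => //; exact: ptk.
- move=> i; rewrite dot_pt Anu big1 // => a _; by rewrite mxE mulr0.
- move=> i j ji; rewrite dot_pt; apply: gen; last exact: Anu'.
  by apply: map_f; rewrite mem_enum.
- move=> i w v wnu vS; have /submxP[D wD] : (w <= A (val i))%MS.
    by rewrite subA; apply/eqP/matrixP => a b; rewrite !ord1 [RHS]mxE; exact: wnu.
  have [v' [v'S eqA exv']] := balanced_opposite (bal (val i)) vS.
  exists v'; split=> //; last by rewrite /dot wD -!mulmxA eqA.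
  by apply/eqP => vv'; move: exv'; rewrite vv'; case: (excess v).
- move=> v v' vS v'S eqc; case: (same_chain vS v'S eqc) => [->|pos|pos].
  + by constructor 1.
  + by constructor 2; exact: cone_diff.
  + by constructor 3; exact: cone_diff.
rewrite card_sig in vs_gt.
pose cs := undup (map chain_of vs); rewrite -/cs in vs_gt.
have csN : {subset cs <= iota 0 (size P + size M)}.
  move=> x; rewrite mem_undup => /mapP[v /vsP[vS _] ->].
  by rewrite mem_iota /= add0n; have [] := chain_ofP vS.
have cs_le := uniq_leq_size (undup_uniq _) csN; rewrite size_iota -/cs in cs_le.
have [nw|] := posnP (#|wall k| + #|wall l|).
  by apply: leq_trans m_le _; rewrite nw addn0 ltnW // (leq_trans vs_gt).
rewrite addn_gt0 => nw.
have [k0 k0kl [i]] : exists2 k0, k0 \in [:: k; l] & exists i, wall k0 i.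
  case/orP: nw => /card_gt0P[i wi]; first by exists k; [rewrite mem_head|exists i].
  by exists l; [rewrite !inE eqxx orbT|exists i].
move=> /eqP wi; have [x xN xmin] := wall_chain k0kl S0 (bal i) (rkA i) wi.
have : (size (x :: cs) <= size (iota 0 (size P + size M)))%N.
  apply: uniq_leq_size => [|y]; last first.
    by rewrite inE => /orP[/eqP->|/csN//]; rewrite mem_iota.
  rewrite /= undup_uniq andbT mem_undup; apply/mapP => -[v /vsP[vS [w wpos vmin]] xv].
  by have := xmin v w vS wpos vmin; rewrite xv eqxx.
(* [#|good| < size cs], and [size cs] is below the number of chains, which leaves room for both
   walls. *)
rewrite size_iota /= => cs_lt; apply: leq_trans m_le _.
apply: leq_trans (leq_add (leqnn _) (leq_add (wall_le1 k) (wall_le1 l))) _.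
by rewrite addn2 (leq_trans _ cs_lt).
Qed.

End ChainBound.

(** * The exponents of a minor as chains, and the bound for common solutions *)

Section CommonSolutions.
Variable n : nat.
Implicit Types (w p q : word n) (E : equation n) (c : 'I_n -> nat).

Definition parikh w : 'cV[rat]_n := \col_x (count_mem x w)%:R.

Definition weight_row c : 'rV[rat]_n := \row_x (c x)%:R.

Lemma parikh_cat p q : parikh (p ++ q) = parikh p + parikh q.
Proof. by apply/matrixP => x j; rewrite !mxE count_cat natrD. Qed.

Lemma wlen_count (T : finType) (d : T -> nat) s :
  wlen d s = (\sum_a d a * count_mem a s)%N.
Proof.
elim: s => [|b s IH]; first by rewrite /wlen big_nil big1 // => a _; rewrite muln0.
rewrite wlen_cons IH /=.
under [RHS]eq_bigr do rewrite mulnDr.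
rewrite big_split /=; congr (_ + _)%N; rewrite (bigD1 b) //= eqxx muln1 big1 ?addn0 // => a.
by rewrite eq_sym => /negPf->; rewrite muln0.
Qed.

Lemma dot_parikh c w : dot (weight_row c) (parikh w) = (wlen c w)%:R.
Proof.
rewrite dotE wlen_count natr_sum; apply: eq_bigr => x _.
by rewrite !mxE natrM.
Qed.

Definition minor_row x w p : seq 'cV[rat]_n := [seq parikh (p ++ q) | q <- prefixes_to x w].

Definition swap_sides E : equation n := (E.2, E.1).

(* The exponents of the monomials with sign + in the minor [Q_(E,k) Q_(E',l) - Q_(E,l) Q_(E',k)],
   grouped by the factor coming from [E]; those with sign - are obtained by exchanging
   the sides of [E']. *)
Definition minor_rows k l E E' : seq (seq 'cV[rat]_n) :=
  map (minor_row l E'.1) (prefixes_to k E.1) ++ map (minor_row l E'.2) (prefixes_to k E.2) ++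
  map (minor_row k E'.2) (prefixes_to l E.1) ++ map (minor_row k E'.1) (prefixes_to l E.2).

Lemma size_minor_rows k l E E' : size (minor_rows k l E E') = (eq_occ E k + eq_occ E l)%N.
Proof. by rewrite !size_cat !size_map !size_prefixes_to /eq_occ !addnA. Qed.

Lemma minor_rowsP k l E E' s : s \in minor_rows k l E E' ->
  exists x w p, x \in [:: k; l] /\ s = minor_row x w p.
Proof.
rewrite !mem_cat => /or4P[] /mapP[p _ ->].
- by exists l, E'.1, p; rewrite !inE eqxx orbT.
- by exists l, E'.2, p; rewrite !inE eqxx orbT.
- by exists k, E'.2, p; rewrite !inE eqxx.
- by exists k, E'.1, p; rewrite !inE eqxx.
Qed.

Lemma pos_at_parikh k l x w : x \in [:: k; l] -> x \in w -> pos_at k l (parikh w).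
Proof.
move=> xkl xw; apply/andP; split; first by apply/forallP => j; rewrite mxE ler0n.
have : 0 < parikh w x 0 by rewrite mxE ltr0n -has_count has_pred1.
by move: xkl; rewrite !inE => /orP[]/eqP-> ->; rewrite ?orbT.
Qed.

Lemma minor_row_chain k l x w p v v' : x \in [:: k; l] ->
  v \in minor_row x w p -> v' \in minor_row x w p ->
  [\/ v = v', pos_at k l (v' - v) | pos_at k l (v - v')].
Proof.
move=> xkl /mapP[q qw ->] /mapP[q' qw' ->].
rewrite !parikh_cat; case: (prefixes_to_comparable qw qw') => [->|[r xr ->]|[r xr ->]].
- by constructor 1.
- by constructor 2; rewrite parikh_cat addrA [X in X - _]addrC addrK (pos_at_parikh xkl).
- by constructor 3; rewrite parikh_cat addrA [X in X - _]addrC addrK (pos_at_parikh xkl).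
Qed.

(** [Num.trunc] turns a rational weight into an exponent; it is exact on Parikh vectors. *)
Let mono c (v : 'cV[rat]_n) : {poly rat} := 'X^(Num.trunc (dot (weight_row c) v)).

Lemma mono_parikh c w : mono c (parikh w) = 'X^(wlen c w).
Proof. by rewrite /mono dot_parikh natrK. Qed.

Lemma sum_minor_row c x w (ps : seq (word n)) :
  \sum_(v <- flatten (map (minor_row x w) ps)) mono c v =
  (\sum_(p <- ps) 'X^(wlen c p)) * qpoly c x w.
Proof.
rewrite big_flatten big_map mulr_suml; apply: eq_bigr => p _.
rewrite big_map mulr_sumr; apply: eq_bigr => q _.
by rewrite mono_parikh wlen_cat exprD.
Qed.

Lemma sum_minor_rows c k l E E' :
  \sum_(v <- flatten (minor_rows k l E E')) mono c v =
  qpoly c k E.1 * qpoly c l E'.1 + qpoly c k E.2 * qpoly c l E'.2 +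
  qpoly c l E.1 * qpoly c k E'.2 + qpoly c l E.2 * qpoly c k E'.1.
Proof. by rewrite !flatten_cat !big_cat /= !sum_minor_row !addrA. Qed.

Lemma eqminor_rows c k l E E' :
  eqminor c E E' k l =
  \sum_(v <- flatten (minor_rows k l E E')) mono c v -
  \sum_(v <- flatten (minor_rows k l E (swap_sides E'))) mono c v.
Proof. by rewrite !sum_minor_rows /eqminor /eqpoly /=; ring. Qed.

Lemma eqminor_unbalanced c k l E E' : eqminor c E E' k l != 0 ->
  exists v, count_mem v (flatten (minor_rows k l E E')) !=
            count_mem v (flatten (minor_rows k l E (swap_sides E'))).
Proof.
rewrite eqminor_rows subr_eq0 => neq.
have : ~~ perm_eq (flatten (minor_rows k l E E')) (flatten (minor_rows k l E (swap_sides E'))).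
  by apply: contraNN neq => /(perm_big _) ->.
by case/allPn=> v _ neqv; exists v.
Qed.

Lemma coef_sum_mono c t (W : seq (word n)) :
  (\sum_(v <- map parikh W) mono c v)`_t = (count (fun w => wlen c w == t) W)%:R.
Proof.
elim: W => [|w W IH]; first by rewrite big_nil coef0.
by rewrite /= big_cons coefD IH mono_parikh coefXn natrD eq_sym.
Qed.

Lemma minor_rows_parikh k l E E' :
  exists W, flatten (minor_rows k l E E') = map parikh W.
Proof.
have row x w (ps : seq (word n)) : exists W, flatten (map (minor_row x w) ps) = map parikh W.
  exists (flatten [seq [seq p ++ q | q <- prefixes_to x w] | p <- ps]).
  rewrite map_flatten -map_comp; congr flatten; apply: eq_map => p /=.
  by rewrite -map_comp.
have [W1 e1] := row l E'.1 (prefixes_to k E.1); have [W2 e2] := row l E'.2 (prefixes_to k E.2).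
have [W3 e3] := row k E'.2 (prefixes_to l E.1); have [W4 e4] := row k E'.1 (prefixes_to l E.2).
by exists (W1 ++ W2 ++ W3 ++ W4); rewrite !flatten_cat e1 e2 e3 e4 !map_cat.
Qed.

(** The row of weighted lengths is a combination of the rows of [gamma h], so it lies in Gamma_h. *)
Lemma dot_lens (h : morph n) (d : 'I_(alph h) -> nat) (v : 'cV[rat]_n) :
  dot (weight_row (lens d)) v = \sum_a (d a)%:R * (gamma h *m v) a 0.
Proof.
transitivity (dot (\row_a (d a)%:R *m gamma h) v).
  congr dot; apply/matrixP => i x; rewrite !mxE /lens wlen_count natr_sum.
  by apply: eq_bigr => a _; rewrite !mxE natrM.
by rewrite /dot -mulmxA mxE; apply: eq_bigr => a _; rewrite mxE.
Qed.

(* For generic letter weights, two exponents occurring in the minor have the same weighted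
   length only if they agree modulo the orthogonal complement of the span of [h]. *)
Lemma common_solution_balanced (h : morph n) k l E E' :
  is_solution h E -> is_solution h E' -> morph_rank h = n.-1 ->
  balanced (minor_rows k l E E') (minor_rows k l E (swap_sides E')) (gamma h).
Proof.
move=> hE hE' rk v0.
have [WP eP] := minor_rows_parikh k l E E'.
have [WM eM] := minor_rows_parikh k l E (swap_sides E').
rewrite eP eM.
case: (boolP (has (fun v => gamma h *m v == gamma h *m v0) (map parikh (WP ++ WM)))); last first.
  by rewrite map_cat has_cat negb_or !has_count -!eqn0Ngt => /andP[/eqP-> /eqP->].
case/hasP=> _ /mapP[w0 _ ->] /eqP <-.
have [d _ gen] := generic_weight
  [seq gamma h *m (v - parikh w0) | v <- map parikh (WP ++ WM)].
have classE w : w \in WP ++ WM ->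
    (gamma h *m parikh w == gamma h *m parikh w0) = (wlen (lens d) w == wlen (lens d) w0).
  move=> wW; rewrite -(eqr_nat rat) -!dot_parikh -subr_eq0 -mulmxBr -[RHS]subr_eq0 -dotBr.
  rewrite dot_lens; apply/idP/idP => [/eqP->|].
    by rewrite big1 // => a _; rewrite mxE mulr0.
  by apply: contraTT => nz; apply: gen => //; do 2 apply: map_f.
rewrite !count_map.
rewrite (@eq_in_count _ _ (fun w => wlen (lens d) w == wlen (lens d) w0) WP); last first.
  by move=> w wP; apply: classE; rewrite mem_cat wP.
rewrite (@eq_in_count _ _ (fun w => wlen (lens d) w == wlen (lens d) w0) WM); last first.
  by move=> w wM; apply: classE; rewrite mem_cat wM orbT.
(* Both class sizes are coefficients at the weighted length of [w0], and the minor vanishes at this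
   solution. *)
apply/eqP; rewrite -(eqr_nat rat) -!coef_sum_mono -eP -eM.
have := common_solution_minor d k l hE hE' rk.
by rewrite eqminor_rows => /eqP; rewrite subr_eq0 => /eqP->.
Qed.

Lemma common_solutions_le c k l E E' m (hs : 'I_m -> morph n) :
  eqminor c E E' k l != 0 ->
  (forall i, [/\ is_solution (hs i) E, is_solution (hs i) E' & morph_rank (hs i) = n.-1]) ->
  (forall i j, i != j -> ~~ lin_equiv (hs i) (hs j)) ->
  (m <= 2 * (eq_occ E k + eq_occ E l))%N.
Proof.
move=> min0 hsol hneq.
rewrite mul2n -addnn -{1}(size_minor_rows k l E E') -(size_minor_rows k l E (swap_sides E')).
apply: (@chain_bound n k l _ _ _ m _ (fun i => gamma (hs i))) => //.
- move=> s; rewrite mem_cat => /orP[]/minor_rowsP[x [w [p [xkl ->]]]] v v'.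
    exact: minor_row_chain.
  exact: minor_row_chain.
- exact: eqminor_unbalanced min0.
- by move=> i a j; rewrite mxE ler0n.
- by move=> i; have [] := hsol i.
- by move=> i; have [hE hE' rk] := hsol i; exact: common_solution_balanced.
Qed.

Lemma eqminor_sym c k l E E' : eqminor c E' E k l = - eqminor c E E' k l.
Proof. by rewrite /eqminor; ring. Qed.

Lemma eq_occ_le k l E : k != l -> (eq_occ E k + eq_occ E l <= eq_len E)%N.
Proof.
move=> kl; have cnt w : (count_mem k w + count_mem l w <= size w)%N.
  rewrite -(count_predUI (pred1 k) (pred1 l)) [X in (_ + X)%N](@eq_count _ _ pred0).
    by rewrite count_pred0 addn0 count_size.
  by move=> x /=; case: eqP => // ->; rewrite (negPf kl).
by rewrite /eq_occ addnACA leq_add.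
Qed.

End CommonSolutions.

Local Close Scope ring_scope.

Theorem theorem4p5 (n : nat) (hn : 2 <= n) (E E' : equation n)
  (hind : strongly_independent E E')
  (m : nat) (hs : 'I_m -> morph n)
  (hsol : forall i, [/\ is_solution (hs i) E, is_solution (hs i) E'
                      & morph_rank (hs i) = n.-1])
  (hneq : forall i j, i != j -> ~~ lin_equiv (hs i) (hs j)) :
  m <= eq_len E + eq_len E' /\
  exists k l : 'I_n, k < l /\ m <= 2 * (eq_occ E k + eq_occ E l).
Proof.
have [[h [hE rk hE']] [h' [_ _ nE]]] := hind.
have nE12 : E.1 != E.2.
  by apply: contraNN nE => /eqP e; rewrite /is_solution e.
have [k [l [c min0]]] := exists_eqminor hE rk hE' nE12.
have kl : k != l.
  by apply: contraNN min0 => /eqP->; rewrite /eqminor GRing.mulrC GRing.subrr.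
have leE := common_solutions_le min0 hsol hneq.
have leE' : m <= 2 * (eq_occ E' k + eq_occ E' l).
  apply: (@common_solutions_le _ c k l E' E m hs) => //.
    by rewrite eqminor_sym GRing.oppr_eq0.
  by move=> i; have [] := hsol i.
split.
  have le_len := leq_add (eq_occ_le E kl) (eq_occ_le E' kl).
  (* The two bounds add up to twice the claim. *)
  rewrite -(@leq_pmul2l 2) // (leq_trans _ (leq_mul (leqnn 2) le_len)) //.
  by rewrite mulnDr mul2n -addnn leq_add.
have [lt|ge|/val_inj e] := ltngtP k l.
- by exists k, l.
- by exists l, k; rewrite addnC.
- by rewrite e eqxx in kl.
Qed.
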